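(* Let $(a_\nu)_{\nu\in\mathbb{Z}_{\ge 0}^3}$ be a family of quaternions, let $$\rho=\limsup_{n\to\infty}\Bigl(\max_{\|\nu\|=n}\Bigl\|\frac{a_\nu}{n!}\Bigr\|\Bigr)^{1/n},$$ and assume $0\le\rho<\infty$. Let $$\tau=\limsup_{n\to\infty}\Bigl(\sum_{\substack{\nu=(n_1,n_2,n_3)\\ \|\nu\|=n,\ a_\nu\ne0}}\binom{n}{n_1,n_2,n_3}\Bigr)^{1/n}.$$ Then the series $$f(x)=\sum_{n=0}^\infty\ \sum_{\substack{\nu=(n_1,n_2,n_3)\\ n_1+n_2+n_3=n}} P_\nu(x)\, a_\nu$$ converges compactly on $B'(0,\tfrac{1}{\tau\rho})$.
   Context: $\mathbb{H}=\{x_0+ix_1+jx_2+kx_3 : x_0,x_1,x_2,x_3\in\mathbb{R}\}$ denotes the quaternions ($i^2=j^2=k^2=ijk=-1$), with Euclidean norm $\|\cdot\|$. For $x=x_0+ix_1+jx_2+kx_3$, the Fueter basis is $\zeta_1(x)=x_1-ix_0$, $\zeta_2(x)=x_2-jx_0$, $\zeta_3(x)=x_3-kx_0$. For a multi-index $\nu=(n_1,n_2,n_3)\in\mathbb{Z}_{\ge0}^3$ put $\|\nu\|=n_1+n_2+n_3=n$, let $A_\nu$ be the set of all words $(i_1,\dots,i_n)$ of length $n$ with exactly $n_1$ letters $1$, $n_2$ letters $2$ and $n_3$ letters $3$, and define $$P_\nu(x)=\frac{1}{n!}\sum_{(i_1,\dots,i_n)\in A_\nu}\zeta_{i_1}(x)\cdots\zeta_{i_n}(x)$$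 (the product over the empty word is $1$). $\binom{n}{n_1,n_2,n_3}=\frac{n!}{n_1!n_2!n_3!}$, and an empty sum is $0$. The auxiliary norm is $\|x_0+ix_1+jx_2+kx_3\|'=\max\{\sqrt{x_0^2+x_1^2},\sqrt{x_0^2+x_2^2},\sqrt{x_0^2+x_3^2}\}$, and $B'(0,r)=\{x\in\mathbb{H}:\|x\|'<r\}$. Convention: if $\tau\rho=0$ then $1/(\tau\rho)=\infty$ and $B'(0,\infty)=\mathbb{H}$. A series $\sum_{n}\sum_{\|\nu\|=n}P_\nu a_\nu$ converges compactly on an open set if its partial sums over $n\le N$ converge, as $N\to\infty$, uniformly on every compact subset of that set. *)

(* Defs.v *)
From HB Require Import structures.
From mathcomp Require Import all_boot all_order all_algebra.
From mathcomp Require Import ring lra.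
From mathcomp Require Import all_classical all_reals all_analysis.

Set Implicit Arguments.
Unset Strict Implicit.
Unset Printing Implicit Defensive.

Import Order.TTheory GRing.Theory Num.Theory.
Import numFieldNormedType.Exports.

Local Open Scope classical_set_scope.
Local Open Scope ring_scope.

(* Quaternions over R: [Quat x0 x1 x2 x3] is x0 + i x1 + j x2 + k x3. *)
Record quat (R : realType) := Quat { qre : R; qi : R; qj : R; qk : R }.

Section QuatAlgebra.
Variable R : realType.
Implicit Types x y z : quat R.

Definition quat_tuple x : R * R * R * R := (qre x, qi x, qj x, qk x).
Definition tuple_quat (t : R * R * R * R) : quat R :=
  Quat t.1.1.1 t.1.1.2 t.1.2 t.2.

Lemma quat_tupleK : cancel quat_tuple tuple_quat.
Proof. by case. Qed.

HB.instance Definition _ := Choice.copy (quat R) (can_type quat_tupleK).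

Lemma quatP x y :
  qre x = qre y -> qi x = qi y -> qj x = qj y -> qk x = qk y -> x = y.
Proof. by case: x y => [????] [????] /= -> -> -> ->. Qed.

Definition quat0 : quat R := Quat 0 0 0 0.
Definition quat1 : quat R := Quat 1 0 0 0.
Definition quat_opp x := Quat (- qre x) (- qi x) (- qj x) (- qk x).
Definition quat_add x y :=
  Quat (qre x + qre y) (qi x + qi y) (qj x + qj y) (qk x + qk y).
Definition quat_mul x y :=
  Quat (qre x * qre y - qi x * qi y - qj x * qj y - qk x * qk y)
       (qre x * qi y + qi x * qre y + qj x * qk y - qk x * qj y)
       (qre x * qj y - qi x * qk y + qj x * qre y + qk x * qi y)
       (qre x * qk y + qi x * qj y - qj x * qi y + qk x * qre y).
Definition quat_scale (c : R) x :=
  Quat (c * qre x) (c * qi x) (c * qj x) (c * qk x).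

Lemma quat_addA : associative quat_add.
Proof. by move=> x y z; apply: quatP => /=; ring. Qed.
Lemma quat_addC : commutative quat_add.
Proof. by move=> x y; apply: quatP => /=; ring. Qed.
Lemma quat_add0 : left_id quat0 quat_add.
Proof. by move=> x; apply: quatP => /=; ring. Qed.
Lemma quat_addN : left_inverse quat0 quat_opp quat_add.
Proof. by move=> x; apply: quatP => /=; ring. Qed.

HB.instance Definition _ :=
  GRing.isZmodule.Build (quat R) quat_addA quat_addC quat_add0 quat_addN.

Lemma quat_mulA : associative quat_mul.
Proof. by move=> x y z; apply: quatP => /=; ring. Qed.
Lemma quat_mul1l : left_id quat1 quat_mul.
Proof. by move=> x; apply: quatP => /=; ring. Qed.
Lemma quat_mul1r : right_id quat1 quat_mul.
Proof. by move=> x; apply: quatP => /=; ring. Qed.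
Lemma quat_mulDl : left_distributive quat_mul +%R.
Proof. by move=> x y z; apply: quatP => /=; ring. Qed.
Lemma quat_mulDr : right_distributive quat_mul +%R.
Proof. by move=> x y z; apply: quatP => /=; ring. Qed.
Lemma quat1_neq0 : quat1 != 0.
Proof. by apply/eqP => /(congr1 (@qre R))/eqP; rewrite oner_eq0. Qed.

HB.instance Definition _ := GRing.Zmodule_isNzRing.Build (quat R)
  quat_mulA quat_mul1l quat_mul1r quat_mulDl quat_mulDr quat1_neq0.

Lemma quat_scaleA a b x : quat_scale a (quat_scale b x) = quat_scale (a * b) x.
Proof. by apply: quatP => /=; ring. Qed.
Lemma quat_scale1 : left_id 1 quat_scale.
Proof. by move=> x; apply: quatP => /=; ring. Qed.
Lemma quat_scaleDr : right_distributive quat_scale +%R.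
Proof. by move=> c x y; apply: quatP => /=; ring. Qed.
Lemma quat_scaleDl x : {morph quat_scale^~ x : a b / a + b}.
Proof. by move=> a b; apply: quatP => /=; ring. Qed.

HB.instance Definition _ := GRing.Zmodule_isLmodule.Build R (quat R)
  quat_scaleA quat_scale1 quat_scaleDr quat_scaleDl.

Lemma quat_scaleAl c x y : c *: (x * y) = (c *: x) * y.
Proof. by apply: quatP => /=; ring. Qed.
Lemma quat_scaleAr c x y : c *: (x * y) = x * (c *: y).
Proof. by apply: quatP => /=; ring. Qed.

HB.instance Definition _ :=
  GRing.Lmodule_isLalgebra.Build R (quat R) quat_scaleAl.
HB.instance Definition _ :=
  GRing.Lalgebra_isAlgebra.Build R (quat R) quat_scaleAr.

Lemma quat_units (i := Quat 0 1 0 0 : quat R) (j := Quat 0 0 1 0 : quat R)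
    (k := Quat 0 0 0 1 : quat R) :
  [/\ i * i = -1, j * j = -1, k * k = -1 & i * j * k = -1].
Proof. by split; apply: quatP => /=; ring. Qed.

Definition quat_norm x : R :=
  Num.sqrt (qre x ^+ 2 + qi x ^+ 2 + qj x ^+ 2 + qk x ^+ 2).

Lemma quat_normD x y : quat_norm (x + y) <= quat_norm x + quat_norm y.
Proof.
case: x y => [a b c d] [a' b' c' d']; rewrite /quat_norm /=.
set X := a ^+ 2 + _ + _ + _; set Y := a' ^+ 2 + _ + _ + _.
have X0 : 0 <= X by rewrite !addr_ge0 ?sqr_ge0.
have Y0 : 0 <= Y by rewrite !addr_ge0 ?sqr_ge0.
have S0 : 0 <= Num.sqrt X + Num.sqrt Y by rewrite addr_ge0 ?sqrtr_ge0.
rewrite -(ger0_norm S0) -sqrtr_sqr ler_wsqrtr// [leRHS]sqrrD !sqr_sqrtr//.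
have CS : a * a' + b * b' + c * c' + d * d' <= Num.sqrt X * Num.sqrt Y.
  rewrite -sqrtrM// (le_trans (ler_norm _))// -sqrtr_sqr ler_wsqrtr//.
  rewrite -subr_ge0 (_ : _ - _ = (a * b' - b * a') ^+ 2 + (a * c' - c * a') ^+ 2
    + (a * d' - d * a') ^+ 2 + (b * c' - c * b') ^+ 2
    + (b * d' - d * b') ^+ 2 + (c * d' - d * c') ^+ 2); last by rewrite /X/Y; ring.
  by rewrite !addr_ge0 ?sqr_ge0.
move: CS; rewrite -mulr_natr; set t := Num.sqrt X * _.
by rewrite /X /Y => CS; lra.
Qed.

Lemma quat_normZ (c : R) x : quat_norm (c *: x) = `|c| * quat_norm x.
Proof.
rewrite /quat_norm /= !exprMn -!mulrDr sqrtrM ?sqr_ge0//.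
by rewrite sqrtr_sqr.
Qed.

Lemma quat_norm0_eq0 x : quat_norm x = 0 -> x = 0.
Proof.
case: x => [a b c d]; rewrite /quat_norm /= => /eqP.
rewrite sqrtr_eq0 => h.
have [a2 b2 c2 d2] := And4 (sqr_ge0 a) (sqr_ge0 b) (sqr_ge0 c) (sqr_ge0 d).
by apply: quatP => /=; apply/eqP; rewrite -sqrf_eq0 eq_le sqr_ge0 andbT; lra.
Qed.

(* [`|x|] is the Euclidean norm, and [quat R] carries its topology. *)
HB.instance Definition _ := Lmodule_isNormed.Build R (quat R)
  quat_normD quat_normZ quat_norm0_eq0.

End QuatAlgebra.

Section FueterSeries.
Variable R : realType.
Implicit Types (x : quat R) (n : nat).

(* The letters 1, 2, 3 are the elements of 'I_3 of value 0, 1, 2. *)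
Definition zeta (l : 'I_3) x : quat R :=
  match val l with
  | 0%N => Quat (qi x) (- qre x) 0 0
  | 1%N => Quat (qj x) 0 (- qre x) 0
  | _ => Quat (qk x) 0 0 (- qre x)
  end.

Definition mindex := {ffun 'I_3 -> nat}.

Definition mdegree (nu : mindex) : nat := (\sum_l nu l)%N.

Definition mindices n : seq mindex :=
  [seq nu <- [seq [ffun l => val (g l)] | g : {ffun 'I_3 -> 'I_n.+1}]
  | mdegree nu == n].

Lemma mem_mindices n nu : (nu \in mindices n) = (mdegree nu == n).
Proof.
rewrite mem_filter andb_idr// => /eqP nun; apply/mapP.
exists [ffun l => inord (nu l)]; first by rewrite mem_enum.
apply/ffunP => l; rewrite !ffunE /= inordK// ltnS -nun /mdegree.
by rewrite (bigD1 l)//= leq_addr.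
Qed.

Lemma mindices_uniq n : uniq (mindices n).
Proof.
rewrite filter_uniq// map_inj_uniq ?enum_uniq// => g h /ffunP gh.
by apply/ffunP => l; apply/val_inj; have := gh l; rewrite !ffunE.
Qed.

Definition words (nu : mindex) : {set (mdegree nu).-tuple 'I_3} :=
  [set w : (mdegree nu).-tuple 'I_3 | [forall l, count_mem l w == nu l]].

Definition fueter (nu : mindex) x : quat R :=
  (mdegree nu)`!%:R^-1 *:
    \sum_(w in words nu) \prod_(l <- w) zeta l x.

Definition multinomial (nu : mindex) : R :=
  (mdegree nu)`!%:R / \prod_l (nu l)`!%:R.

Definition fueter_sum (a : mindex -> quat R) N x : quat R :=
  \sum_(0 <= n < N.+1) \sum_(nu <- mindices n) fueter nu x * a nu.

(* The term n = 0 of the sequences below, where n^-1 = 0, is irrelevant to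
   the limit superior. *)
Definition rho (a : mindex -> quat R) : \bar R :=
  limn_esup (fun n =>
    ((\big[Num.max/0]_(nu <- mindices n) `|n`!%:R^-1 *: a nu|)
       `^ n%:R^-1)%:E).

Definition tau (a : mindex -> quat R) : \bar R :=
  limn_esup (fun n =>
    ((\sum_(nu <- mindices n | a nu != 0) multinomial nu) `^ n%:R^-1)%:E).

Definition aux_norm x : R :=
  Num.max (Num.max (Num.sqrt (qre x ^+ 2 + qi x ^+ 2))
                   (Num.sqrt (qre x ^+ 2 + qj x ^+ 2)))
          (Num.sqrt (qre x ^+ 2 + qk x ^+ 2)).

Definition aux_ball (r : \bar R) : set (quat R) :=
  [set x | ((aux_norm x)%:E < r)%E].

Definition converges_compactly (U : set (quat R)) (u : nat -> quat R -> quat R) :=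
  exists f : quat R -> quat R,
    forall K : set (quat R), compact K -> K `<=` U -> {uniform K, u @ \oo --> f}.

End FueterSeries.

(* Main.v *)
(* The quaternionic norm is multiplicative and |zeta_l x| <= |x|', so the block
   of degree n is bounded by S_n M_n |x|'^n, where S_n sums the multinomials of
   the nonzero coefficients and M_n is the largest |a_nu / n!|. On a compact
   subset of B'(0, 1 / (tau rho)) the continuous function |x|' attains a maximum
   r with r tau rho < 1, so the blocks are eventually dominated by a geometric
   sequence of ratio r (tau + d) (rho + d) < 1. *)
Require Import Defs.
From HB Require Import structures.
From mathcomp Require Import all_boot all_order all_algebra.
From mathcomp Require Import ring lra.
From mathcomp Require Import all_classical all_reals all_analysis.

Set Implicit Arguments.
Unset Strict Implicit.
Unset Printing Implicit Defensive.

Import Order.TTheory GRing.Theory Num.Theory.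
Import numFieldNormedType.Exports.

Local Open Scope ring_scope.

(** * Counting words with prescribed letter counts *)

Section WordCount.
Variable I : finType.
Implicit Types (n : nat) (c : {ffun I -> nat}).

(** The length [n] is independent of [c] so that induction on [n] is possible; [words nu] is the
    instance [n = mdegree nu]. *)
Definition words_of n c : {set n.-tuple I} :=
  [set w : n.-tuple I | [forall l, count_mem l w == c l]].

(** Split off the first letter [l]: the tail uses [l] once less. The truncated subtraction is
    harmless since [c l] is positive. *)
Lemma card_words_ofS n c :
  #|words_of n.+1 c| =
  (\sum_(l | (0 < c l)%N) #|words_of n [ffun m => c m - (l == m)]|)%N.
Proof.
rewrite -sum1_card; under eq_bigl do rewrite inE.
rewrite (reindex (fun p : I * n.-tuple I => [tuple of p.1 :: p.2])) /=; last first.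
  exists (fun w : n.+1.-tuple I => (thead w, [tuple of behead w])).
    by move=> [l t] _ /=; congr (_, _); apply: val_inj.
  by move=> w _; rewrite [RHS]tuple_eta; apply: val_inj.
rewrite -(pair_big_dep xpredT
  (fun l (t : n.-tuple I) => [forall m, ((l == m) + count_mem m t)%N == c m])
  (fun _ _ => 1%N)) /=.
rewrite [RHS]big_mkcond; apply: eq_bigr => l _; case: ifP => cl.
  rewrite -sum1_card; apply: eq_bigl => t; rewrite inE.
  apply: eq_forallb => m; rewrite ffunE.
  case: (eqVneq l m) => [<-|_]; last by rewrite subn0.
  by case: (c l) cl => // k _; rewrite /= subn1 add1n eqSS.
rewrite big1// => t /forallP/(_ l).
by rewrite eqxx => /eqP e; move: cl; rewrite -e.
Qed.

(** Division-free multinomial formula. In the recurrence, first letter [l] contributes [c l * n!],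
    because [(c l)! = c l * (c l - 1)!], and the [c l] add up to [n + 1]. *)
Lemma card_words_of n c : (\sum_l c l = n)%N ->
  (#|words_of n c| * \prod_l (c l)`! = n`!)%N.
Proof.
elim: n c => [|n IH] c cn.
  have c0 l : c l = 0%N.
    by apply/eqP; rewrite -leqn0 -cn (bigD1 l)//= leq_addr.
  rewrite big1 ?muln1; last by move=> l _; rewrite c0.
  rewrite (_ : words_of 0 c = [set [tuple]]) ?cards1//.
  by apply/setP => w; rewrite !inE tuple0 eqxx; apply/forallP => l; rewrite c0.
rewrite card_words_ofS big_distrl /= factS -cn big_distrl /= [RHS](bigID (fun l => 0 < c l)%N) /=.
rewrite [X in (_ + X)%N]big1 ?addn0; last first.
  by move=> l; rewrite lt0n negbK => /eqP ->.
apply: eq_bigr => l cl; set d := [ffun m => _].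
have dE m : m != l -> d m = c m by move=> ml; rewrite ffunE eq_sym (negbTE ml) subn0.
have dl : d l = (c l).-1 by rewrite ffunE eqxx subn1.
have <- : (#|words_of n d| * \prod_m (d m)`! = n`!)%N.
  apply: IH; apply: succn_inj; rewrite -cn (bigD1 l)//= [in RHS](bigD1 l)//= -addSn.
  by rewrite dl prednK//; congr addn; apply: eq_bigr => m /dE.
rewrite (bigD1 l)//= [in RHS](bigD1 l)//= dl [in RHS](eq_bigr (fun m => (c m)`!)); last first.
  by move=> m /dE ->.
by rewrite -[in LHS](prednK cl) factS prednK// -mulnA mulnCA.
Qed.

End WordCount.

(** * Norm estimates for the Fueter polynomials and the blocks *)

Section Bounds.
Variable R : realType.
Implicit Types (x y : quat R) (n : nat) (nu : mindex).

Lemma quat_normE x : `|x| = quat_norm x. Proof. by []. Qed.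

Lemma quat_normM x y : `|x * y| = `|x| * `|y|.
Proof.
rewrite !quat_normE /quat_norm -sqrtrM ?addr_ge0 ?sqr_ge0//.
by congr Num.sqrt => /=; ring.
Qed.

Lemma quat_norm1 : `|1 : quat R| = 1.
Proof. by rewrite quat_normE /quat_norm /= expr1n expr0n /= !addr0 sqrtr1. Qed.

Lemma aux_norm_ge0 x : 0 <= aux_norm x.
Proof. by rewrite !le_max sqrtr_ge0. Qed.

(** The three square roots in [aux_norm] are exactly the norms of the [zeta l x]. *)
Lemma aux_norm_leP x (r : R) :
  reflect (forall l, `|zeta l x| <= r) (aux_norm x <= r).
Proof.
have [e0 e1 e2] : [/\ Num.sqrt (qre x ^+ 2 + qi x ^+ 2) = `|zeta (inord 0) x|,
    Num.sqrt (qre x ^+ 2 + qj x ^+ 2) = `|zeta (inord 1) x| &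
    Num.sqrt (qre x ^+ 2 + qk x ^+ 2) = `|zeta (inord 2) x|].
  rewrite /zeta /= !inordK// !quat_normE /quat_norm /=.
  by split; congr Num.sqrt; ring.
rewrite /aux_norm e0 e1 e2 !ge_max -andbA; apply: (iffP and3P) => [[h0 h1 h2] l|h].
  rewrite -(inord_val l); case: l => [[|[|[|[]]]]]//.
by split; exact: h.
Qed.

Lemma norm_zeta_le l x : `|zeta l x| <= aux_norm x.
Proof. by move: l; apply/aux_norm_leP. Qed.

Lemma zetaD l x y : zeta l (x + y) = zeta l x + zeta l y.
Proof. by rewrite /zeta; case: val => [|[|n]]; apply: quatP => /=; ring. Qed.

Lemma norm_zeta_le_norm l x : `|zeta l x| <= `|x|.
Proof.
have := (sqr_ge0 (qre x), sqr_ge0 (qi x), sqr_ge0 (qj x), sqr_ge0 (qk x)).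
move=> [[[? ?] ?] ?]; rewrite !quat_normE /quat_norm /zeta.
by case: val => [|[|n]] /=; apply: ler_wsqrtr; lra.
Qed.

(** Each [zeta l] is additive and does not increase the norm, so their maximum satisfies a reverse
    triangle inequality. *)
Lemma aux_norm_lipschitz x y : `|aux_norm x - aux_norm y| <= `|x - y|.
Proof.
have h (u v : quat R) : aux_norm u - aux_norm v <= `|u - v|.
  rewrite lerBlDl; apply/aux_norm_leP => l; rewrite -[u in zeta l u](subrKC v) zetaD.
  rewrite (le_trans (ler_normD _ _))// lerD ?norm_zeta_le//.
  exact: norm_zeta_le_norm.
by rewrite ler_norml h lerNl opprB distrC h.
Qed.

Lemma aux_norm_continuous : continuous (@aux_norm R).
Proof.
move=> x; have Fx : Filter (nbhs x) := nbhs_filter x.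
apply/(@cvgrPdist_lt _ R _ (nbhs x) Fx) => e e0.
apply: filterS (nbhsx_ballx x e e0) => y; rewrite -ball_normE /=.
exact: le_lt_trans (aux_norm_lipschitz _ _).
Qed.

Lemma norm_prod_zeta_le (w : seq 'I_3) x :
  `|\prod_(l <- w) zeta l x| <= aux_norm x ^+ size w.
Proof.
elim: w => [|l w IH]; first by rewrite big_nil quat_norm1.
by rewrite big_cons quat_normM exprS ler_pM// norm_zeta_le.
Qed.

Lemma card_words nu : (#|words nu|)%:R = multinomial R nu.
Proof.
rewrite /multinomial -(@card_words_of _ _ nu erefl) natrM natr_prod mulfK//.
by rewrite prodf_seq_neq0; apply/allP => l _; rewrite pnatr_eq0 -lt0n fact_gt0.
Qed.

Lemma multinomial_ge0 nu : 0 <= multinomial R nu.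
Proof. by rewrite -card_words. Qed.

(** A word determines its letter counts, so the sets counted by the multinomials are disjoint among
    the [3 ^ n] words of length [n]. *)
Lemma sum_multinomial_le n : \sum_(nu <- mindices n) multinomial R nu <= 3 ^+ n.
Proof.
rewrite big_seq (eq_bigr (fun nu => (#|words_of n nu|)%:R)); last first.
  by move=> nu; rewrite mem_mindices => /eqP <-; rewrite -card_words.
rewrite -big_seq -natr_sum -natrX ler_nat.
under eq_bigr do rewrite -sum1_card big_mkcond /=.
rewrite exchange_big /= [leqRHS](_ : _ = #|{: n.-tuple 'I_3}|); last first.
  by rewrite card_tuple card_ord.
rewrite -sum1_card leq_sum// => w _.
rewrite -big_mkcond sum1_count.
rewrite (@eq_count _ _ (pred1 [ffun l => count_mem l w])).
  by rewrite count_uniq_mem ?mindices_uniq// leq_b1.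
move=> nu; rewrite !inE; apply/forallP/eqP => [h|-> l]; last by rewrite ffunE.
by apply/ffunP => l; rewrite ffunE (eqP (h l)).
Qed.

Lemma norm_fueter_le nu x :
  `|fueter nu x| <= (mdegree nu)`!%:R^-1 * (multinomial R nu * aux_norm x ^+ mdegree nu).
Proof.
rewrite normrZ ger0_norm ?invr_ge0// ler_wpM2l ?invr_ge0//.
rewrite (le_trans (ler_norm_sum _ _ _))// -card_words -sum1_card natr_sum mulr_suml.
by apply: ler_sum => w _; rewrite mul1r (le_trans (norm_prod_zeta_le _ _))// size_tuple.
Qed.

(** [max_coef] and [count_coef] are the expressions under the [n]-th roots in [rho] and [tau]. *)
Definition max_coef (a : mindex -> quat R) n : R :=
  \big[Num.max/0]_(nu <- mindices n) `|n`!%:R^-1 *: a nu|.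

Definition count_coef (a : mindex -> quat R) n : R :=
  \sum_(nu <- mindices n | a nu != 0) multinomial R nu.

Lemma max_coef_ge0 a n : 0 <= max_coef a n.
Proof. by rewrite /max_coef; elim/big_ind : _ => // u v u0 _; rewrite le_max u0. Qed.

Lemma count_coef_ge0 a n : 0 <= count_coef a n.
Proof. by apply: sumr_ge0 => nu _; exact: multinomial_ge0. Qed.

Lemma count_coef_le a n : count_coef a n <= 3 ^+ n.
Proof.
apply: le_trans (sum_multinomial_le n); rewrite /count_coef big_mkcond /=.
by apply: ler_sum => nu _; case: ifP => // _; exact: multinomial_ge0.
Qed.

Lemma norm_block_le a n x :
  `|\sum_(nu <- mindices n) fueter nu x * a nu|
  <= count_coef a n * max_coef a n * aux_norm x ^+ n.
Proof.
rewrite (le_trans (ler_norm_sum _ _ _))// (bigID (fun nu => a nu != 0)) /=.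
rewrite [X in _ + X]big1 ?addr0; last first.
  by move=> nu; rewrite negbK => /eqP ->; rewrite mulr0 normr0.
rewrite /count_coef -mulrA mulr_suml big_seq_cond [leRHS]big_seq_cond.
apply: ler_sum => nu /andP[nun _].
have anu : `|n`!%:R^-1 *: a nu| <= max_coef a n.
  by rewrite /max_coef (bigD1_seq nu)//= ?mindices_uniq// le_max lexx.
move: nun; rewrite mem_mindices => /eqP nun.
rewrite quat_normM (le_trans (ler_wpM2r _ (norm_fueter_le _ _)))// nun.
(* The factor [1 / n!] of the Fueter polynomial is moved onto the coefficient, where [max_coef]
   expects it. *)
rewrite [leLHS](_ : _ = multinomial R nu * (`|n`!%:R^-1 *: a nu| * aux_norm x ^+ n)).
  by rewrite ler_wpM2l ?multinomial_ge0// ler_wpM2r ?exprn_ge0 ?aux_norm_ge0.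
by rewrite normrZ ger0_norm ?invr_ge0//; ring.
Qed.

Lemma quat_coord_le x :
  [/\ `|qre x| <= `|x|, `|qi x| <= `|x|, `|qj x| <= `|x| & `|qk x| <= `|x|].
Proof.
have := (sqr_ge0 (qre x), sqr_ge0 (qi x), sqr_ge0 (qj x), sqr_ge0 (qk x)).
move=> [[[? ?] ?] ?]; rewrite quat_normE /quat_norm -!sqrtr_sqr.
by split; apply: ler_wsqrtr; lra.
Qed.

Lemma norm_quat_le x : `|x| <= `|qre x| + `|qi x| + `|qj x| + `|qk x|.
Proof.
rewrite quat_normE /quat_norm -[leRHS]ger0_norm ?addr_ge0// -sqrtr_sqr.
apply: ler_wsqrtr; rewrite -!(real_normK (num_real (_ x))).
have := (normr_ge0 (qre x), normr_ge0 (qi x), normr_ge0 (qj x), normr_ge0 (qk x)).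
move=> [[[? ?] ?] ?]; nra.
Qed.

End Bounds.

(** * Limits superior of roots and geometric convergence *)

Section Sequences.
Variable R : realType.

Lemma root_lim_sup_lt (u : nat -> R) (l : R) : (forall n, 0 <= u n) ->
  (limn_esup (fun n => (u n `^ n%:R^-1)%:E) < l%:E)%E ->
  exists N, forall n, (N <= n)%N -> u n <= l ^+ n.
Proof.
move=> u0 /ereal_inf_lt[_ /= [V [N _ NV] <-] Vl].
(* The successor forces [n > 0], so that the root can be undone by the [n]-th power. *)
exists N.+1 => n Nn; have n0 : n%:R != 0 :> R by rewrite pnatr_eq0 -lt0n (leq_ltn_trans _ Nn).
have un : u n `^ n%:R^-1 <= l.
  rewrite -lee_fin (le_trans _ (ltW Vl))//; apply: ereal_sup_ubound => /=.
  by exists n => //; apply: NV => /=; exact: ltnW.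
rewrite -[u n]powRr1// -(mulVf n0) powRrM powR_mulrn ?powR_ge0//.
by rewrite lerXn2r// nnegrE ?powR_ge0// (le_trans _ un)// powR_ge0.
Qed.

Lemma root_lim_sup_le (u : nat -> R) (l : R) : 0 <= l ->
  (forall n, 0 <= u n <= l ^+ n) ->
  (limn_esup (fun n => (u n `^ n%:R^-1)%:E) <= l%:E)%E.
Proof.
(* The index 0 is left out: its term is [u 0] to the power 0, that is 1, which may exceed [l]. *)
move=> l0 ul; apply: ge_ereal_inf; exists (ereal_sup
    ((fun n => (u n `^ n%:R^-1)%:E) @` [set n | (0 < n)%N]%classic)) => /=.
  by exists [set n | (0 < n)%N]%classic => //; exists 1%N.
apply: ge_ereal_sup => _ [n /= n0 <-]; rewrite lee_fin.
have nn0 : n%:R != 0 :> R by rewrite pnatr_eq0 -lt0n.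
have /andP[un0 unl] := ul n.
rewrite [leRHS](_ : l = (l ^+ n) `^ n%:R^-1); last first.
  by rewrite -powR_mulrn// -powRrM mulfV// powRr1.
by apply: ge0_ler_powR; rewrite ?nnegrE ?invr_ge0 ?exprn_ge0.
Qed.

Lemma dist_lim_geometric (u : nat -> R) (q : R) N : 0 <= q < 1 ->
  (forall n, (N <= n)%N -> `|u n.+1 - u n| <= q ^+ n) ->
  forall n, (N <= n)%N -> `|limn u - u n| <= q ^+ n / (1 - q).
Proof.
move=> /andP[q0 q1] uq; have q1' : 0 < 1 - q by rewrite subr_gt0.
(* Telescoping, with the exact value of the finite geometric sum, which makes the induction on [m]
   close. *)
have dist n m : (N <= n)%N -> `|u (n + m)%N - u n| <= (q ^+ n - q ^+ (n + m)) / (1 - q).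
  move=> Nn; elim: m => [|m IH]; first by rewrite addn0 !subrr normr0 mul0r.
  rewrite -(subrKA (u (n + m)%N)) (le_trans (ler_normD _ _))//.
  rewrite (_ : _ / _ = q ^+ (n + m) + (q ^+ n - q ^+ (n + m)) / (1 - q)).
    by rewrite lerD// addnS uq// (leq_trans Nn)// leq_addr.
  by rewrite addnS exprS; field; rewrite gt_eqF.
have {}dist n m : (N <= n <= m)%N -> `|u m - u n| <= q ^+ n / (1 - q).
  move=> /andP[Nn nm]; rewrite -(subnKC nm) (le_trans (dist _ _ Nn))//.
  by rewrite ler_pM2r ?invr_gt0// gerBl exprn_ge0.
have q0lim : ((fun n => q ^+ n / (1 - q)) @ \oo --> (0 : R))%classic.
  rewrite -[X in (_ --> X)%classic](mul0r (1 - q)^-1); apply: cvgMl.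
  by apply: cvg_expr; rewrite ger0_norm.
have cu : cvgn u.
  apply/cauchy_cvgP/cauchy_exP => e e0.
  have [M _ Mq] := cvgr_lt _ q0lim _ e0.
  exists (u (maxn N M)); exists (maxn N M) => // m /= Mm.
  rewrite -ball_normE /= distrC (le_lt_trans (dist _ _ _))//.
    by rewrite leq_maxl.
  by apply: Mq; rewrite /= leq_maxr.
(* The bound passes to the limit through an index beyond both [n] and the rank where [u] is
   [e]-close to its limit. *)
move=> n Nn; apply/ler_addgt0Pr => e e0.
have [M _ Mu] := @cvgr_dist_lt _ R _ _ _ _ _ cu _ e0.
rewrite -(subrKA (u (maxn n M))) addrC (le_trans (ler_normD _ _))// lerD//.
  by apply: dist; rewrite Nn leq_maxl.
by apply/ltW/Mu; rewrite /= leq_maxr.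
Qed.

(* [quat R] is not declared complete, so the limit is built coordinatewise. *)
Definition quat_lim (u : nat -> quat R) : quat R :=
  Quat (limn (@qre R \o u)) (limn (@qi R \o u))
       (limn (@qj R \o u)) (limn (@qk R \o u)).

(** The 4 counts the coordinates. The bound depends on [u] only through [q] and [N], which is what
    yields uniformity later. *)
Lemma dist_quat_lim_geometric (u : nat -> quat R) (q : R) N : 0 <= q < 1 ->
  (forall n, (N <= n)%N -> `|u n.+1 - u n| <= q ^+ n) ->
  forall n, (N <= n)%N -> `|quat_lim u - u n| <= 4 * (q ^+ n / (1 - q)).
Proof.
move=> q01 uq n Nn; apply: le_trans (norm_quat_le _) _.
have D (f : quat R -> R) : (forall x y, f x - f y = f (x - y)) ->
    (forall x, `|f x| <= `|x|) -> `|limn (f \o u) - f (u n)| <= q ^+ n / (1 - q).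
  move=> fB fle; apply: (dist_lim_geometric (u := f \o u) q01 _ Nn) => m Nm /=.
  by rewrite fB (le_trans (fle _))// uq.
have d0 : `|limn (@qre R \o u) - qre (u n)| <= q ^+ n / (1 - q).
  by apply: D => // x; have [] := quat_coord_le x.
have d1 : `|limn (@qi R \o u) - qi (u n)| <= q ^+ n / (1 - q).
  by apply: D => // x; have [] := quat_coord_le x.
have d2 : `|limn (@qj R \o u) - qj (u n)| <= q ^+ n / (1 - q).
  by apply: D => // x; have [] := quat_coord_le x.
have d3 : `|limn (@qk R \o u) - qk (u n)| <= q ^+ n / (1 - q).
  by apply: D => // x; have [] := quat_coord_le x.
by rewrite /=; lra.
Qed.

Lemma perturb_lt1 (r t p : R) : 0 <= r -> 0 <= t -> 0 <= p -> r * (t * p) < 1 ->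
  exists2 d, 0 < d & r * ((t + d) * (p + d)) < 1.
Proof.
(* For [d <= 1], expanding with [d * d <= d] gives at most [r * (t * p) + d * (D - 1)], which equals
   [1 - d] for this [d]. *)
move=> r0 t0 p0 h; pose D := r * (t + p + 1) + 1; pose d := (1 - r * (t * p)) / D.
have rtp0 : 0 <= r * (t * p) by rewrite !mulr_ge0.
have D1 : 1 <= D by rewrite /D lerDr mulr_ge0// !addr_ge0.
have D0 : 0 < D by lra.
have dD : d * D = 1 - r * (t * p) by rewrite /d mulfVK// gt_eqF.
have d0 : 0 < d by rewrite divr_gt0// subr_gt0.
have d1 : d <= 1 by rewrite ler_pdivrMr//; lra.
exists d => //.
have : r * d * d <= r * d by rewrite ler_piMr// mulr_ge0// ltW.
by move: dD; rewrite /D; lra.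
Qed.

End Sequences.

(** * Compact subsets of the auxiliary ball and uniform convergence *)

Lemma aux_ball_le_compact (R : realType) (c : \bar R) (K : set (quat R)) :
  (0 < c)%E -> compact K -> (K `<=` aux_ball c)%classic ->
  exists r : R, [/\ 0 <= r, (r%:E < c)%E & forall x, K x -> aux_norm x <= r].
Proof.
(* An empty [K] has no maximum point; there [r = 0] works because [c] is positive. Otherwise the
   maximum is attained in [K], which keeps the inequality with [c] strict. *)
move=> c0 cK Kc; have [->|/set0P K0] := eqVneq K set0.
  by exists 0; split.
have [|y yK ymax] := compact_EVT_max K0 cK (f := @aux_norm R).
  exact: continuous_subspaceT (@aux_norm_continuous R).
exists (aux_norm y); split; first exact: aux_norm_ge0.
  by apply: Kc; rewrite -inE.
by move=> x Kx; apply: ymax; rewrite inE.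
Qed.

(* The inverse on [\bar R] satisfies 0^-1 = +oo. *)
Theorem theorem3p0p5 (R : realType) (a : mindex -> quat R)
    (hrho : (0 <= rho a < +oo)%E) :
  converges_compactly (aux_ball ((tau a * rho a)^-1)%E) (fueter_sum a).
Proof.
(* One limit function has to serve every [K], so it is defined pointwise beforehand. *)
exists (fun x => quat_lim (fueter_sum a ^~ x)) => K cK Kc.
have tau_ge0 : (0 <= tau a)%E.
  by apply: limf_esup_ge0 => [|n]; [exact: filter_not_empty|rewrite lee_fin powR_ge0].
(* Finiteness is assumed for [rho a] only; this bound gives it for [tau a], so the product is a real
   number. *)
have tau_le : (tau a <= 3%:E)%E.
  by apply: root_lim_sup_le => // n; rewrite count_coef_ge0 count_coef_le.
have [t tE] : exists t, tau a = t%:E.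
  by exists (fine (tau a)); rewrite fineK// ge0_fin_numE// (le_lt_trans tau_le)// ltry.
have [p pE] : exists p, rho a = p%:E.
  by exists (fine (rho a)); rewrite fineK// ge0_fin_numE//; case/andP: hrho.
have t0 : 0 <= t by rewrite -lee_fin -tE.
have p0 : 0 <= p by rewrite -lee_fin -pE; case/andP: hrho.
rewrite tE pE -EFinM in Kc.
have c0 : (0 < (t * p)%:E^-1)%E.
  by rewrite inver; case: eqVneq => // tp0; rewrite lte_fin invr_gt0 lt_def tp0 mulr_ge0.
have [r [r0 rc Kr]] := aux_ball_le_compact c0 cK Kc.
have rtp : r * (t * p) < 1.
  (* If [t * p = 0] the radius is infinite and [r] is unconstrained, but the product is 0. *)
  move: rc; rewrite inver; case: eqVneq => [->|tp0]; first by rewrite mulr0.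
  by rewrite lte_fin -div1r ltr_pdivlMr// lt_def tp0 mulr_ge0.
have [d d0 dlt] := perturb_lt1 r0 t0 p0 rtp.
set q := r * _ in dlt.
have q0 : 0 <= q by rewrite !mulr_ge0// addr_ge0// ltW.
have [N1 hN1] : exists N, forall n, (N <= n)%N -> count_coef a n <= (t + d) ^+ n.
  apply: root_lim_sup_lt; first exact: count_coef_ge0.
  by rewrite -[limn_esup _]/(tau a) tE lte_fin ltrDl.
have [N2 hN2] : exists N, forall n, (N <= n)%N -> max_coef a n <= (p + d) ^+ n.
  apply: root_lim_sup_lt; first exact: max_coef_ge0.
  by rewrite -[limn_esup _]/(rho a) pE lte_fin ltrDl.
pose N := maxn N1 N2.
have step x n : K x -> (N <= n)%N ->
    `|fueter_sum a n.+1 x - fueter_sum a n x| <= q ^+ n.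
  move=> Kx; rewrite geq_max => /andP[n1 n2].
  rewrite /fueter_sum [X in X - _]big_nat_recr//= addrAC subrr add0r (le_trans (norm_block_le _ _ _))//.
  (* The difference is the block of degree [n + 1]; one factor [q < 1] is given up to match the
     geometric lemma. *)
  apply: (@le_trans _ _ (q ^+ n.+1)); last by rewrite exprS ler_piMl ?exprn_ge0// ltW.
  rewrite /q !exprMn mulrC ler_pM ?exprn_ge0 ?mulr_ge0 ?aux_norm_ge0 ?count_coef_ge0 ?max_coef_ge0//.
    by rewrite lerXn2r ?nnegrE ?aux_norm_ge0 ?Kr.
  by rewrite ler_pM ?count_coef_ge0 ?max_coef_ge0// ?hN1 ?hN2// ltnW.
have qlim : ((fun n => 4 * (q ^+ n / (1 - q))) @ \oo --> (0 : R))%classic.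
  rewrite -[X in (_ --> X)%classic](mulr0 4) -[X in 4 * X](mul0r (1 - q)^-1).
  by apply: cvgMr; apply: cvgMl; apply: cvg_expr; rewrite ger0_norm.
move=> P /uniform_nbhs[E [entE EP]].
move: entE; rewrite -entourage_ballE => -[e e0 eE].
(* The rank [M] comes from a numerical sequence and is thus the same for all [x] in [K]. *)
have [M _ Mq] := cvgr_lt _ qlim _ e0.
exists (maxn N M) => // n; rewrite /= geq_max => /andP[Nn Mn].
apply: EP => x Kx; apply: eE => /=; rewrite -ball_normE /=.
apply: le_lt_trans (Mq n Mn).
by apply: (dist_quat_lim_geometric (u := fueter_sum a ^~ x) (N := N)) => //; [rewrite q0|move=> m; exact: step].
Qed.
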